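(* Let $r\ge 1$, let $\lambda=(\lambda_1\ge\lambda_2\ge\cdots\ge\lambda_r\ge 0)$ be a partition with $r$ parts (some possibly zero), let $N\ge\lambda_1+r-1$, let $\mathbf{z}=(z_1,\dots,z_r)\in(\mathbb{C}^\times)^r$, and let $w\in S_r$. Then the partition function of the colored five-vertex system $\mathfrak{S}_{\mathbf{z},\lambda,w}$ satisfies $$Z(\mathfrak{S}_{\mathbf{z},\lambda,w})=\mathbf{z}^{\rho}\,\partial^\circ_w\,\mathbf{z}^{\lambda}.$$
   Context: Colored five-vertex system $\mathfrak{S}_{\mathbf{z},\lambda,w}$: take a grid with $r$ horizontal lines (rows, labeled $1,\dots,r$ from top to bottom) and $N+1$ vertical lines (columns, labeled $N,N-1,\dots,0$ from left to right); vertices are the intersections, and each vertex has a left, top, right and bottom adjacent edge; boundary edges are those attached to only one vertex. Fix a totally ordered set of colors $c_1>c_2>\cdots>c_r$. A colored spin is either $+$ or a color. Boundary conditions: the top boundary edge in column $\lambda_k+r-k$ carries color $c_k$ ($k=1,\dots,r$), all other top boundary edges carry $+$; all left and bottom boundary edges carry $+$; the right boundary edge of row $k$ carries color $c_{w^{-1}(k)}$. A state is an assignment of colored spins to all interior edges. The Boltzmann weight of a vertex in row $k$ whose (left, top, right, bottom) edges carry $(\ell,t,\rho',b)$ is: $1$ for $(+,+,+,+)$; $z_k$ for $(c,d,\max(c,d),\min(c,d))$ with $c,d$ colors (possibly equal); $z_k$ for $(c,+,c,+)$; $z_k$ for $(c,+,+,c)$; $1$ for $(+,c,c,+)$ (here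 $c$ any color); and $0$ for every other configuration (in particular $(+,c,+,c)$ has weight $0$). The weight $\beta(\mathfrak{s})$ of a state is the product of the weights of its vertices, and $Z(\mathfrak{S}_{\mathbf{z},\lambda,w})=\sum_{\mathfrak{s}}\beta(\mathfrak{s})$ over all states. Notation: $\mathbf{z}^\mu=\prod_i z_i^{\mu_i}$ for $\mu\in\mathbb{Z}^r$, $\rho=(r-1,r-2,\dots,1,0)$. $S_r$ acts on functions of $\mathbf{z}$ by permuting variables; $s_i$ is the transposition $(i,i+1)$. For $1\le i\le r-1$ and a Laurent polynomial $f$, $\partial^\circ_i f(\mathbf{z})=\dfrac{f(\mathbf{z})-f(s_i\mathbf{z})}{z_i/z_{i+1}-1}$. These satisfy the braid relations, so for $w=s_{i_1}\cdots s_{i_k}$ reduced, $\partial^\circ_w=\partial^\circ_{i_1}\cdots\partial^\circ_{i_k}$ is well defined, with $\partial^\circ_1=1$. *)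

(* Defs.v *)
From HB Require Import structures.
From Stdlib Require ClassicalEpsilon.
From mathcomp Require Import all_boot all_order all_fingroup all_algebra.
From mathcomp Require Import ssrAC generic_quotient fraction.
From mathcomp Require Import reals.
From mathcomp Require Import complex.
From mathcomp Require Import mpoly.

Set Implicit Arguments.
Unset Strict Implicit.
Unset Printing Implicit Defensive.

Import GRing.Theory.
Local Open Scope ring_scope.

(* Rows and colors are numbered from 0: [Some k] is the color c_(k+1), so the
   larger of two colors is the one with the smaller index.  [None] is +. *)
Definition spin (r : nat) : finType := option 'I_r.

Definition max_color (r : nat) (c d : 'I_r) : 'I_r := if (c <= d)%N then c else d.
Definition min_color (r : nat) (c d : 'I_r) : 'I_r := if (c <= d)%N then d else c.

Definition vertex_weight (K : fieldType) (r : nat) (zk : K)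
    (left top right bottom : spin r) : K :=
  match left, top, right, bottom with
  | None, None, None, None => 1
  | Some c, Some d, Some e, Some f =>
      if (e == max_color c d) && (f == min_color c d) then zk else 0
  | Some c, None, Some d, None => if d == c then zk else 0
  | Some c, None, None, Some d => if d == c then zk else 0
  | None, Some c, Some d, None => if d == c then 1 else 0
  | _, _, _, _ => 0
  end.

(* A state assigns spins to the interior edges.  In the first component the
   index (k, j) is the horizontal edge of row k between columns j+1 and j; in
   the second one it is the vertical edge of column j between rows k and k+1
   (rows counted from 0). *)
Definition state (r N : nat) : finType :=
  ({ffun 'I_r * 'I_N -> spin r} * {ffun 'I_r.-1 * 'I_N.+1 -> spin r})%type.

Definition top_spin (r : nat) (lam : 'I_r -> nat) (j : nat) : spin r :=
  [pick k : 'I_r | lam k + (r - k.+1) == j]%N.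

(* The horizontal edge of row k to the right of column m; it is the right
   boundary edge if m = 0, and the left boundary edge if m = N+1. *)
Definition horizontal_spin (r N : nat) (w : 'S_r) (s : state r N)
    (k : 'I_r) (m : nat) : spin r :=
  if m is j.+1 then oapp (fun j' => s.1 (k, j')) None (insub j : option 'I_N)
  else Some ((w^-1)%g k).

(* The vertical edge of column j above row n (counted from 0); it is the top
   boundary edge if n = 0, and the bottom boundary edge if n = r. *)
Definition vertical_spin (r N : nat) (lam : 'I_r -> nat) (s : state r N)
    (n : nat) (j : 'I_N.+1) : spin r :=
  if n is k.+1 then oapp (fun k' => s.2 (k', j)) None (insub k : option 'I_r.-1)
  else top_spin lam j.

Definition state_weight (K : fieldType) (r N : nat) (z : 'I_r -> K)
    (lam : 'I_r -> nat) (w : 'S_r) (s : state r N) : K :=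
  \prod_(k < r) \prod_(j < N.+1)
    vertex_weight (z k)
      (horizontal_spin w s k j.+1) (vertical_spin lam s k j)
      (horizontal_spin w s k j) (vertical_spin lam s k.+1 j).

Definition partition_function (K : fieldType) (r N : nat) (z : 'I_r -> K)
    (lam : 'I_r -> nat) (w : 'S_r) : K :=
  \sum_(s : state r N) state_weight z lam w s.

(* Laurent polynomials are handled as elements of the field of rational
   functions, in which the quotient defining the divided difference makes
   sense.  [laurent] below singles them out; it is stable under the operators
   used here ([demazure_laurent], [laurentM], [laurent_monomial]). *)
Notation ratfun K r := {fraction {mpoly K[r]}}.
Notation "p %:F" := (@FracField.tofrac _ p) : ring_scope.

Definition var (K : fieldType) (r : nat) (i : 'I_r) : ratfun K r := ('X_i)%:F.

Definition monomial (K : fieldType) (r : nat) (mu : 'I_r -> int) : ratfun K r :=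
  \prod_(i < r) var K i ^ mu i.

Definition rho (r : nat) (i : 'I_r) : int := (r - i.+1)%N.

Definition permute_vars (K : fieldType) (r : nat) (s : 'S_r) (f : ratfun K r) :
    ratfun K r :=
  (msym s \n_(repr f))%:F / (msym s \d_(repr f))%:F.

Definition ord_lo (r : nat) (i : 'I_r.-1) : 'I_r := widen_ord (leq_pred r) i.

Lemma ord_hi_subproof (r : nat) (i : 'I_r.-1) : (i.+1 < r)%N.
Proof. by rewrite -ltn_predRL. Qed.

Definition ord_hi (r : nat) (i : 'I_r.-1) : 'I_r := Ordinal (ord_hi_subproof i).

Definition simple_refl (r : nat) (i : 'I_r.-1) : 'S_r :=
  tperm (ord_lo i) (ord_hi i).

Definition demazure_op (K : fieldType) (r : nat) (i : 'I_r.-1) (f : ratfun K r) :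
    ratfun K r :=
  (f - permute_vars (simple_refl i) f) / (var K (ord_lo i) / var K (ord_hi i) - 1).

(* Products in S_r are compositions of maps, (uv)(x) = u(v(x)), which is the
   opposite of [mulg] on permutations. *)
Definition word_perm (r : nat) (s : seq 'I_r.-1) : 'S_r :=
  foldr (fun i v => (v * simple_refl i)%g) 1%g s.

Definition reduced_word (r : nat) (w : 'S_r) (s : seq 'I_r.-1) : bool :=
  (word_perm s == w) &&
  [forall n : 'I_(size s), forall t : n.-tuple 'I_r.-1, word_perm t != w].

Lemma word_perm_cat (r : nat) (s t : seq 'I_r.-1) :
  word_perm (s ++ t) = (word_perm t * word_perm s)%g.
Proof.
by elim: s => [|i s IHs] /=; rewrite ?mulg1 // IHs mulgA.
Qed.

Lemma word_perm_tperm (r : nat) (a b : 'I_r) :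
  exists s : seq 'I_r.-1, word_perm s = tperm a b.
Proof.
wlog le_ab : a b / (a <= b)%N => [hw|].
  by case: (leqP a b) => [|/ltnW] /hw // [s hs]; exists s; rewrite hs tpermC.
move: {2}(b - a)%N (erefl (b - a)%N) => n; elim: n => [|n IHn] in b le_ab *.
  move=> ba; have -> : b = a by apply/val_inj/eqP; rewrite eqn_leq le_ab -subn_eq0 ba /=.
  by exists [::]; rewrite /= tperm1.
move=> ba; have lt_ab : (a < b)%N by rewrite -subn_gt0 ba.
have b1P : (b.-1 < r.-1)%N.
  by rewrite ltn_predRL prednK ?ltn_ord // (leq_ltn_trans _ lt_ab).
pose i : 'I_r.-1 := Ordinal b1P.
have hiE : ord_hi i = b by apply/val_inj; rewrite /= prednK // (leq_ltn_trans _ lt_ab).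
have [||s hs] := IHn (ord_lo i); rewrite /= ?subn1.
- by rewrite -ltnS prednK // (leq_ltn_trans _ lt_ab).
- by rewrite -subn1 subnAC ba subn1.
case: (eqVneq (ord_lo i) a) => [loE|neq_lo].
  by exists [:: i]; rewrite /= mul1g /simple_refl loE hiE.
exists (i :: s ++ [:: i]).
have siV : (simple_refl i)^-1%g = simple_refl i by rewrite tpermV.
rewrite /= word_perm_cat /= mul1g hs -{1}siV -mulgA -/(conjg _ _) tpermJ.
rewrite /simple_refl tpermL tpermD // ?hiE //.
by rewrite eq_sym; apply: contraTneq lt_ab => ->; rewrite ltnn.
Qed.

Lemma word_perm_surj (r : nat) (w : 'S_r) :
  exists s : seq 'I_r.-1, word_perm s = w.
Proof.
have [ts -> _] := prod_tpermP w; elim: ts => [|t ts [s hs]].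
  by exists [::]; rewrite big_nil.
have [u hu] := word_perm_tperm t.1 t.2.
by exists (s ++ u); rewrite big_cons word_perm_cat hs hu.
Qed.

Lemma reduced_word_exists (r : nat) (w : 'S_r) :
  exists s : seq 'I_r.-1, reduced_word w s.
Proof.
have exP : exists n, [exists t : n.-tuple 'I_r.-1, word_perm t == w].
  have [s <-] := word_perm_surj w.
  by exists (size s); apply/existsP; exists (in_tuple s).
case: (ex_minnP exP) => n /existsP [t /eqP ht] minn.
exists t; rewrite /reduced_word ht eqxx /=; apply/forallP => m; apply/forallP => u.
apply/negP => hu; have := ltn_ord m; rewrite [X in (_ < X)%N]size_tuple ltnNge.
by rewrite minn //; apply/existsP; exists u.
Qed.

(* By the braid relations the result does not depend on the reduced word. *)
Definition demazure (K : fieldType) (r : nat) (w : 'S_r) (f : ratfun K r) :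
    ratfun K r :=
  foldr (fun i g => demazure_op i g) f (xchoose (reduced_word_exists w)).

Definition laurent (K : fieldType) (r : nat) (f : ratfun K r) : Prop :=
  exists (p : {mpoly K[r]}) (m : 'X_{1..r}), f = p%:F / 'X_[m]%:F.

Definition laurent_value (K : fieldType) (r : nat) (z : 'I_r -> K)
    (f : ratfun K r) (v : K) : Prop :=
  exists (p : {mpoly K[r]}) (m : 'X_{1..r}),
    f = p%:F / 'X_[m]%:F /\ v = p.@[z] / 'X_[m].@[z].

(* Meaningful for Laurent f and z with nonzero coordinates, where the value is
   unique; see [laurent_evalE]. *)
Definition laurent_eval (K : fieldType) (r : nat) (z : 'I_r -> K)
    (f : ratfun K r) : K :=
  ClassicalEpsilon.epsilon (inhabits 0) (laurent_value z f).

Section LaurentFacts.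
Variables (K : fieldType) (r : nat).
Implicit Types (p q : {mpoly K[r]}) (f g : ratfun K r) (s : 'S_r).

Lemma meval_neq0 (z : 'I_r -> K) (m : 'X_{1..r}) :
  (forall i, z i != 0) -> 'X_[m].@[z] != 0.
Proof. by move=> hz; rewrite mevalX; apply/prodf_neq0 => i _; rewrite expf_neq0. Qed.

Lemma tofrac_neq0 p : p != 0 -> p%:F != 0.
Proof. by rewrite tofrac_eq0. Qed.

Lemma mpolyX_neq0 (m : 'X_{1..r}) : 'X_[K, m] != 0.
Proof.
apply/eqP => /(congr1 (mcoeff m)); rewrite mcoeffX mcoeff0 eqxx => /eqP.
by rewrite oner_eq0.
Qed.

Lemma mpolyX_tofrac_neq0 (m : 'X_{1..r}) : 'X_[K, m]%:F != 0.
Proof. by rewrite tofrac_neq0 // mpolyX_neq0. Qed.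

Lemma eq_tofrac_div p q p' q' : q != 0 -> q' != 0 ->
  (p%:F / q%:F = p'%:F / q'%:F) <-> p * q' = p' * q.
Proof.
move=> q0 q'0; split => [/eqP|h].
  by rewrite eqr_div ?tofrac_neq0 // -!tofracM tofrac_eq => /eqP.
by apply/eqP; rewrite eqr_div ?tofrac_neq0 // -!tofracM h.
Qed.

Lemma laurent_evalE (z : 'I_r -> K) p (m : 'X_{1..r}) :
  (forall i, z i != 0) ->
  laurent_eval z (p%:F / 'X_[m]%:F) = p.@[z] / 'X_[m].@[z].
Proof.
move=> hz; rewrite /laurent_eval.
have ex : exists v, laurent_value z (p%:F / 'X_[m]%:F) v.
  by exists (p.@[z] / 'X_[m].@[z]), p, m.
have [q [n [/eq_tofrac_div h ->]]] := ClassicalEpsilon.epsilon_spec (inhabits 0) _ ex.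
apply/eqP; rewrite eqr_div ?meval_neq0 // -!mevalM; apply/eqP; congr (_.@[z]).
by rewrite h // mpolyX_neq0.
Qed.

Lemma ratfun_numden f : f = (\n_(repr f))%:F / (\d_(repr f))%:F.
Proof.
rewrite -[LHS]reprK; set x := repr f; unlock FracField.tofrac.
rewrite -[X in _ = _ * X]FracField.pi_inv -[RHS]FracField.pi_mul.
rewrite /FracField.mulf /FracField.invf !numden_Ratio ?oner_neq0 ?denom_ratioP //.
by rewrite mulr1 mul1r Ratio_numden.
Qed.

Lemma msym_eq0 s p : (msym s p == 0) = (p == 0).
Proof.
apply/eqP/eqP => [h|->]; last exact: msym0.
by rewrite -[p]msym1m -(mulgV s) msymMm h msym0.
Qed.

Lemma permute_vars_frac s p q : q != 0 ->
  permute_vars s (p%:F / q%:F) = (msym s p)%:F / (msym s q)%:F.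
Proof.
move=> q0; rewrite /permute_vars; set f := p%:F / q%:F.
have d0 : \d_(repr f) != 0 by apply: denom_ratioP.
have sd0 : msym s \d_(repr f) != 0 by rewrite msym_eq0.
have sq0 : msym s q != 0 by rewrite msym_eq0.
apply: (proj2 (eq_tofrac_div _ _ sd0 sq0)); rewrite -!msymM; congr msym.
by apply: (proj1 (eq_tofrac_div _ _ d0 q0)); rewrite -ratfun_numden.
Qed.

Lemma msym_tperm_dvd (a b : 'I_r) p :
  exists q, p - msym (tperm a b) p = ('X_a - 'X_b) * q.
Proof.
pose D p := exists q, p - msym (tperm a b) p = ('X_a - 'X_b) * q.
have DM p1 p2 : D p1 -> D p2 -> D (p1 * p2).
  move=> [q1 h1] [q2 h2]; exists (p1 * q2 + q1 * msym (tperm a b) p2).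
  rewrite mulrDr mulrCA -h2 (mulrA _ q1) -h1 msymM mulrBl mulrBr.
  by rewrite addrA subrK.
have DC c : D c%:MP by exists 0; rewrite /msym mmapC subrr mulr0.
have DX i : D 'X_i.
  rewrite /D /msym mmapX mmap1U; case: tpermP => [->|->|_ _].
  - by exists 1; rewrite mulr1.
  - by exists (-1); rewrite mulrN1 opprB.
  - by exists 0; rewrite subrr mulr0.
have Dm m : D 'X_[m].
  rewrite mpolyXE_id; elim/big_ind: _ => // [|i _]; first exact: (DC 1).
  by elim: (m i) => [|n IHn]; [rewrite expr0; exact: (DC 1) | rewrite exprS; apply: DM].
rewrite -/(D p) [p]mpolyE; elim/big_ind: _ => [|p1 p2 [q1 h1] [q2 h2]|m _].
- exact: (DC 0).
- by exists (q1 + q2); rewrite msymD opprD addrACA h1 h2 mulrDr.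
- by rewrite -mul_mpolyC; apply: DM.
Qed.

Lemma demazure_op_laurent (i : 'I_r.-1) f : laurent f -> laurent (demazure_op i f).
Proof.
move=> [p [m ->]]; rewrite /demazure_op permute_vars_frac ?mpolyX_neq0 //.
set s := simple_refl i; set m' := [multinom m ((s^-1)%g j) | j < r].
have sX : msym s 'X_[m] = 'X_[m'] :> {mpoly K[r]} by rewrite msymX.
have ss q : msym s (msym s q) = q by rewrite -msymMm tperm2 msym1m.
have [q hq] := msym_tperm_dvd (ord_lo i) (ord_hi i) (p * 'X_[m']).
have lohi : 'X_(ord_lo i) - 'X_(ord_hi i) != 0 :> {mpoly K[r]}.
  rewrite subr_eq0; apply/eqP => /(congr1 (fun p : {mpoly K[r]} => p@_U_(ord_lo i)%MM)).
  rewrite !mcoeffXU eqxx.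
  have -> : (ord_hi i == ord_lo i) = false by rewrite -val_eqE /= eqn_leq ltnn.
  by move/eqP; rewrite oner_eq0.
have hi0 : ('X_(ord_hi i) : {mpoly K[r]})%:F != 0 := mpolyX_tofrac_neq0 _.
exists ('X_(ord_hi i) * q), (m + m')%MM.
rewrite /var sX -[X in _ / (_ - X)](divff hi0) -mulrBl -tofracB.
rewrite -mulNr -tofracN addf_div ?mpolyX_tofrac_neq0 // -!tofracM -tofracD -mpolyXD.
have -> : p * 'X_[m'] + - msym s p * 'X_[m] = ('X_(ord_lo i) - 'X_(ord_hi i)) * q.
  by rewrite -hq mulNr -/s msymM -sX ss.
rewrite invf_div mulf_div -!tofracM; apply/eq_tofrac_div.
- by rewrite mulf_neq0 // mpolyX_neq0.
- by rewrite mpolyX_neq0.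
by rewrite [LHS](ACl ((3*2)*(4*1))).
Qed.

Lemma demazure_laurent (w : 'S_r) f : laurent f -> laurent (demazure w f).
Proof.
rewrite /demazure => hf; elim: (xchoose _) => //= i t IHt.
exact: demazure_op_laurent.
Qed.

Lemma laurentM f g : laurent f -> laurent g -> laurent (f * g).
Proof.
move=> [p [m ->]] [q [n ->]]; exists (p * q), (m + n)%MM.
by rewrite mulf_div mpolyXD !tofracM.
Qed.

Lemma laurent_monomial (mu : 'I_r -> int) : laurent (monomial K mu).
Proof.
have l1 : laurent (1 : ratfun K r).
  by exists 1, 0%MM; rewrite mpolyX0 tofrac1 divr1.
apply: big_ind => // [|i _]; first exact: laurentM.
case: (mu i) => n; rewrite /exprz.
  by exists ('X_i ^+ n), 0%MM; rewrite mpolyX0 tofrac1 divr1 tofracXn.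
by exists 1, (U_(i) *+ n.+1)%MM; rewrite -mpolyXn tofracXn tofrac1 div1r.
Qed.

End LaurentFacts.

(* Main.v *)
(* Summing over states row by row writes the partition function as a product of
   row transfer matrices.  A Yang--Baxter equation, pushed through all columns
   of rows i and i+1, exchanges their parameters; since + on both left edges is
   an eigenvector of the braid, it gives, for w^-1(i) < w^-1(i+1),
     (z_i - z_(i+1)) Z(s_i w) = z_(i+1) Z(w) - z_i s_i(Z(w)),
   which says that z^-rho Z(s_i w) is the i-th divided difference of
   z^-rho Z(w).  The inequality holds along a reduced word by the exchange
   property.  For w = 1 a single state contributes: in row k the color c_k
   enters from the top at column lambda_k + r - k and runs straight to the
   right boundary. *)

Require Import Defs.
From mathcomp Require Import all_boot all_order all_fingroup all_algebra.
From mathcomp Require Import reals complex.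
From mathcomp Require Import mpoly fraction ring zify.

Set Implicit Arguments.
Unset Strict Implicit.
Unset Printing Implicit Defensive.

Import GRing.Theory.
Local Open Scope ring_scope.

(** * Finite functions read as sequences with a default value *)

Section FfunCons.
Variable X : Type.

Definition ffun_nth (d : X) n (f : {ffun 'I_n -> X}) (k : nat) : X :=
  oapp f d (insub k).

Definition fcons n (x : X) (f : {ffun 'I_n -> X}) : {ffun 'I_n.+1 -> X} :=
  [ffun i => oapp f x (unlift ord0 i)].

Lemma ffun_nth_ord d n (f : {ffun 'I_n -> X}) (k : 'I_n) : ffun_nth d f k = f k.
Proof. by rewrite /ffun_nth valK. Qed.

Lemma ffun_nth_fcons0 d n x (f : {ffun 'I_n -> X}) : ffun_nth d (fcons x f) 0 = x.
Proof. by rewrite /ffun_nth (valK (ord0 : 'I_n.+1)) /= ffunE unlift_none. Qed.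

Lemma ffun_nth_fconsS d n x (f : {ffun 'I_n -> X}) k :
  ffun_nth d (fcons x f) k.+1 = ffun_nth d f k.
Proof.
rewrite /ffun_nth; case: insubP => [i /= lt_i Ei|/= ge_k]; last first.
  by rewrite insubF // -ltnS (negbTE ge_k).
have lt_k : (k < n)%N by rewrite -ltnS.
have -> : i = lift ord0 (Ordinal lt_k) by apply: val_inj.
by rewrite ffunE liftK /= (insubT (fun k => (k < n)%N) lt_k).
Qed.

End FfunCons.

Lemma sum_ffunS (A : comNzRingType) (X : finType) n (F : {ffun 'I_n.+1 -> X} -> A) :
  \sum_f F f = \sum_x \sum_(f : {ffun 'I_n -> X}) F (fcons x f).
Proof.
rewrite pair_big /= (reindex (fun p : X * {ffun 'I_n -> X} => fcons p.1 p.2)) //=.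
exists (fun f => (f ord0, [ffun i => f (lift ord0 i)])) => [[x f] _|f _] /=.
  rewrite ffunE unlift_none /=; congr (_, _).
  by apply/ffunP => i; rewrite !ffunE liftK.
by apply/ffunP => i; rewrite ffunE; case: unliftP => [j|] -> //=; rewrite ffunE.
Qed.

(** * Products of transfer matrices *)

Section Chain.
Variable A : comNzRingType.

Lemma sum_delta (X : finType) (y : X) (F : X -> A) : \sum_x (x == y)%:R * F x = F y.
Proof.
rewrite (bigD1 y) //= eqxx mul1r big1 ?addr0 // => x /negbTE->.
by rewrite mul0r.
Qed.

Lemma sum_deltar (X : finType) (y : X) (F : X -> A) : \sum_x F x * (x == y)%:R = F y.
Proof. by rewrite -[RHS]sum_delta; apply: eq_bigr => x _; rewrite mulrC. Qed.

(** Entry [(x, y)] of the product of the [n] matrices [T 0], [T 1], and so on, in this order. *)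
Fixpoint chain (X : finType) (T : nat -> X -> X -> A) n (x y : X) : A :=
  if n is n'.+1 then \sum_u T 0%N x u * chain (fun k => T k.+1) n' u y
  else (x == y)%:R.

Lemma eq_chain (X : finType) (T U : nat -> X -> X -> A) n x y :
  (forall k x y, (k < n)%N -> T k x y = U k x y) -> chain T n x y = chain U n x y.
Proof.
elim: n T U x => //= n IHn T U x eqTU; apply: eq_bigr => u _.
by rewrite eqTU //; congr (_ * _); apply: IHn => k ? ? lt_k; apply: eqTU.
Qed.

(** [v] lists only the [n] intermediate indices; position [n] is out of range, so the default [y] of
    [ffun_nth] supplies the endpoint. *)
Lemma chain_paths (X : finType) (T : nat -> X -> X -> A) n x y :
  chain T n.+1 x y =
  \sum_(v : {ffun 'I_n -> X}) \prod_(k < n.+1)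
    T k (if (k : nat) is j.+1 then ffun_nth y v j else x) (ffun_nth y v k).
Proof.
elim: n T x => [|n IHn] T x.
  rewrite /= sum_deltar (big_pred1 [ffun=> y]) => [|v]; last first.
    by apply/esym/eqP/ffunP => -[].
  by rewrite big_ord_recl big_ord0 mulr1 /= /ffun_nth insubF.
rewrite sum_ffunS; transitivity (\sum_u T 0%N x u * chain (fun k => T k.+1) n.+1 u y) => //.
apply: eq_bigr => u _; rewrite IHn mulr_sumr; apply: eq_bigr => v _.
rewrite [RHS]big_ord_recl /= ffun_nth_fcons0; congr (_ * _).
apply: eq_bigr => k _; rewrite /bump /= !add1n ffun_nth_fconsS; congr T.
by case: k => -[|k] //= _; rewrite ?ffun_nth_fcons0 ?ffun_nth_fconsS.
Qed.

Lemma chain_intertwine (X : finType) (T U : nat -> X -> X -> A) (S : X -> X -> A) n :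
  (forall k x y, (k < n)%N -> \sum_u T k x u * S u y = \sum_u S x u * U k u y) ->
  forall x y, \sum_u chain T n x u * S u y = \sum_u S x u * chain U n u y.
Proof.
elim: n T U => [|n IHn] T U TS x y /=.
  rewrite sum_deltar -[RHS](sum_delta x (fun u => S u y)).
  by apply: eq_bigr => u _; rewrite eq_sym.
under eq_bigr do rewrite mulr_suml.
rewrite exchange_big /=.
under eq_bigr => v _.
  under eq_bigr do rewrite -mulrA.
  rewrite -mulr_sumr (IHn _ (fun k => U k.+1)) => [|k ? ? lt_k]; last exact: TS.
  rewrite mulr_sumr; under eq_bigr do rewrite mulrA.
  over.
rewrite exchange_big /=.
under eq_bigr do rewrite -mulr_suml TS // mulr_suml.
rewrite exchange_big /=; apply: eq_bigr => u _.
by rewrite mulr_sumr; apply: eq_bigr => v _; rewrite mulrA.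
Qed.

(** The three products differ only in two adjacent factors, so multilinearity carries a relation
    between these two-step products to the whole chains. It serves to change two neighbouring rows
    of the grid. *)
Lemma chain_linear (X : finType) (T U V : nat -> X -> X -> A) (a b c : A) i n x y :
  (i.+1 < n)%N ->
  (forall k x y, k != i -> k != i.+1 -> U k x y = T k x y) ->
  (forall k x y, k != i -> k != i.+1 -> V k x y = T k x y) ->
  (forall x y, a * (\sum_u T i x u * T i.+1 u y) =
     b * (\sum_u U i x u * U i.+1 u y) + c * (\sum_u V i x u * V i.+1 u y)) ->
  a * chain T n x y = b * chain U n x y + c * chain V n x y.
Proof.
elim: i n T U V x => [|i IHi] [|n] T U V x //.
  case: n => // n _ eqU eqV eqT /=.
  have step W : (forall k x y, W k.+2 x y = T k.+2 x y) ->
      \sum_u W 0%N x u * (\sum_v W 1%N u v * chain (fun k => W k.+2) n v y) =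
      \sum_v (\sum_u W 0%N x u * W 1%N u v) * chain (fun k => T k.+2) n v y.
    move=> eqW; under eq_bigr do rewrite mulr_sumr.
    rewrite exchange_big /=; apply: eq_bigr => v _; rewrite mulr_suml.
    apply: eq_bigr => u _; rewrite mulrA; congr (_ * _).
    by apply: eq_chain => k ? ? _; apply: eqW.
  rewrite !step // => [|k ? ?|k ? ?]; [|exact: eqV|exact: eqU].
  rewrite !mulr_sumr -big_split /=; apply: eq_bigr => v _.
  by rewrite !mulrA -mulrDl eqT.
rewrite ltnS => lt_i eqU eqV eqT /=.
rewrite !mulr_sumr -big_split /=; apply: eq_bigr => u _.
rewrite eqU // eqV // !(mulrCA _ (T 0%N x u)) -mulrDr; congr (_ * _).
by apply: IHi => // k ? ? ? ?; [apply: eqU|apply: eqV].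
Qed.

(** Row [c k] of [T k] vanishes off [c k.+1], so a single path survives. *)
Lemma chain_deterministic (X : finType) (T : nat -> X -> X -> A) (c : nat -> X)
    (a : nat -> A) n y :
  (forall k u, (k < n)%N -> T k (c k) u = a k * (u == c k.+1)%:R) ->
  chain T n (c 0%N) y = \prod_(k < n) a k * (c n == y)%:R.
Proof.
elim: n T c a => [|n IHn] T c a Tc /=; first by rewrite big_ord0 mul1r.
under eq_bigr do rewrite Tc // -mulrA mulrCA.
rewrite sum_delta (IHn _ (fun k => c k.+1) (fun k => a k.+1)) => [|k u lt_k]; last exact: Tc.
by rewrite big_ord_recl mulrA.
Qed.

(** With the two chains as adjacent rows and [v] as the vertical edges between them, this regroups a
    two-row sum column by column. *)
Lemma chain_couple (B X Y : finType) (d : B) (T : nat -> B -> X -> X -> A)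
    (U : nat -> B -> Y -> Y -> A) n x x' y y' :
  \sum_(v : {ffun 'I_n -> B})
     chain (fun j => T j (ffun_nth d v j)) n x x' *
     chain (fun j => U j (ffun_nth d v j)) n y y' =
  chain (fun j (p q : X * Y) => \sum_m T j m p.1 q.1 * U j m p.2 q.2) n (x, y) (x', y').
Proof.
elim: n T U x y => [|n IHn] T U x y /=.
  rewrite (big_pred1 [ffun=> d]) => [|v]; last by apply/esym/eqP/ffunP => -[].
  by rewrite -natrM mulnb xpair_eqE.
rewrite sum_ffunS.
under [RHS]eq_bigr do rewrite mulr_suml.
rewrite [RHS]exchange_big; apply: eq_bigr => m _ /=.
rewrite (eq_bigr (fun u => \sum_(f : {ffun 'I_n -> B}) T 0%N m x u.1 * U 0%N m y u.2 *
   (chain (fun j => T j.+1 (ffun_nth d f j)) n u.1 x' *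
    chain (fun j => U j.+1 (ffun_nth d f j)) n u.2 y'))) /=; last first.
  by move=> [u v] _; rewrite -mulr_sumr (IHn (fun j => T j.+1) (fun j => U j.+1)).
rewrite exchange_big /=; apply: eq_bigr => f _.
rewrite ffun_nth_fcons0 big_distrl /=.
under eq_bigr do rewrite big_distrr.
rewrite pair_big /=; apply: eq_bigr => -[u v] _ /=.
rewrite [LHS]mulrACA; congr (_ * (_ * _)).
  by apply: eq_chain => k ? ? _; rewrite ffun_nth_fconsS.
by apply: eq_chain => k ? ? _; rewrite ffun_nth_fconsS.
Qed.

End Chain.

(** * Vertex weights and the local Yang--Baxter equation *)

Section Vertex.
Variables (A : comNzRingType) (r : nat).
Implicit Types (x y z : A) (l t b : spin r) (c d : 'I_r).

(* [vertex_weight] over an arbitrary ring, since polynomials in the spectral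
   parameters do not form a field. *)
Definition ring_weight z l t (p : spin r) b : A :=
  match l, t, p, b with
  | None, None, None, None => 1
  | Some c, Some d, Some e, Some f =>
      if (e == max_color c d) && (f == min_color c d) then z else 0
  | Some c, None, Some d, None => if d == c then z else 0
  | Some c, None, None, Some d => if d == c then z else 0
  | None, Some c, Some d, None => if d == c then 1 else 0
  | _, _, _, _ => 0
  end.

(** A vertex as an operator on functions of its right and bottom edges. Composing such operators
    replaces sums over interior edges by substitution. *)
Definition vertex_op z (F : spin r -> spin r -> A) l t : A :=
  match l, t with
  | None, None => F None None
  | Some c, Some d => z * F (Some (max_color c d)) (Some (min_color c d))
  | Some c, None => z * F (Some c) None + z * F None (Some c)
  | None, Some c => F (Some c) None
  end.

Lemma ring_weightE z l t (p b : spin r) :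
  ring_weight z l t p b =
  match l, t with
  | None, None => ((p, b) == (None, None))%:R
  | Some c, Some d => ((p, b) == (Some (max_color c d), Some (min_color c d)))%:R * z
  | Some c, None =>
      ((p, b) == (Some c, None))%:R * z + ((p, b) == (None, Some c))%:R * z
  | None, Some c => ((p, b) == (Some c, None))%:R
  end.
Proof.
by case: l t p b => [?|] [?|] [?|] [?|]; rewrite ?xpair_eqE /=
  ?(inj_eq Some_inj) ?andbT ?andbF /= ?mul0r ?mul1r ?add0r ?addr0 //;
  case: ifP; rewrite ?mul0r ?mul1r.
Qed.

Lemma ring_weight_sum z F l t :
  \sum_p \sum_b ring_weight z l t p b * F p b = vertex_op z F l t.
Proof.
rewrite pair_big /=.
under eq_bigr => p _ do rewrite ring_weightE -surjective_pairing.
case: l t => [c|] [d|] /=.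
- by under eq_bigr do rewrite -mulrA; rewrite sum_delta.
- under eq_bigr do rewrite mulrDl -!mulrA.
  by rewrite big_split /= !sum_delta.
- by rewrite sum_delta.
- by rewrite sum_delta.
Qed.

Lemma eq_vertex_op z F G l t : F =2 G -> vertex_op z F l t = vertex_op z G l t.
Proof. by move=> eqFG; case: l t => [?|] [?|] /=; rewrite !eqFG. Qed.

(** The R-matrix of a crossing of two horizontal lines, in the same operator form. The left boundary
    will see its factor [x] at [(None, None)], the right one its mixing of two colors. *)
Definition braid_op x y (F : spin r -> spin r -> A) l l' : A :=
  match l, l' with
  | None, None => x * F None None
  | None, Some c => y * F None (Some c) + (y - x) * F (Some c) None
  | Some c, None => x * F (Some c) None
  | Some c, Some d =>
      if (c <= d)%N then y * F (Some c) (Some d)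
      else x * F (Some c) (Some d) + (y - x) * F (Some d) (Some c)
  end.

(** For an arbitrary test function [F], Yang--Baxter is a polynomial identity in each case of the
    incoming spins and of the order of their colors. *)
Lemma vertex_op_braid x y (F : spin r -> spin r -> spin r -> A) l l' t :
  braid_op x y (fun a a' => vertex_op y (fun p m =>
      vertex_op x (fun p' b => F p p' b) a' m) a t) l l' =
  vertex_op x (fun p m => vertex_op y (fun p' b =>
      braid_op x y (fun a a' => F a a' b) p p') l' m) l t.
Proof.
case: l l' t => [c|] [d|] [e|] /=; rewrite /max_color /min_color.
all: repeat case: ifP => ?.
all: try ring.
all: try by exfalso; lia.
(* In each of the three cases left, the comparisons force two colors to coincide. *)
- have -> : e = d by apply: val_inj => /=; lia.
  ring.
- have -> : d = c by apply: val_inj => /=; lia.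
  ring.
- have -> : e = d by apply: val_inj => /=; lia.
  ring.
Qed.

Definition braid_weight x y (p q : spin r * spin r) : A :=
  braid_op x y (fun a a' => ((a, a') == q)%:R) p.1 p.2.

Lemma braid_weight_sum x y F (p : spin r * spin r) :
  \sum_q braid_weight x y p q * F q = braid_op x y (fun a a' => F (a, a')) p.1 p.2.
Proof.
have delta k a : \sum_q k * (a == q)%:R * F q = k * F a.
  under eq_bigr do rewrite -mulrA eq_sym.
  by rewrite -mulr_sumr sum_delta.
have delta2 k k' a a' :
    \sum_q (k * (a == q)%:R + k' * (a' == q)%:R) * F q = k * F a + k' * F a'.
  by under eq_bigr do rewrite mulrDl; rewrite big_split /= !delta.
by case: p => [[c|] [d|]]; rewrite /braid_weight /=; try case: ifP => _;
  rewrite ?delta ?delta2.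
Qed.

(* A column of two consecutive rows with parameters [x] (upper) and [y]
   (lower); [p] and [q] hold the spins of its left and right edges. *)
Definition column_weight x y t b (p q : spin r * spin r) : A :=
  \sum_m ring_weight x p.1 t q.1 m * ring_weight y p.2 m q.2 b.

Lemma column_weight_sum x y t b p F :
  \sum_q column_weight x y t b p q * F q =
  vertex_op x (fun a m => vertex_op y (fun a' b' => (b' == b)%:R * F (a, a'))
    p.2 m) p.1 t.
Proof.
rewrite -ring_weight_sum.
rewrite (eq_bigr (fun q => column_weight x y t b p (q.1, q.2) * F (q.1, q.2))); last by case.
rewrite -(pair_bigA _ (fun a a' => column_weight x y t b p (a, a') * F (a, a'))) /=.
apply: eq_bigr => a _; rewrite /column_weight /=.
under eq_bigr do rewrite mulr_suml.
rewrite exchange_big; apply: eq_bigr => m _ /=.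
rewrite -ring_weight_sum mulr_sumr; apply: eq_bigr => a' _.
under [in RHS]eq_bigr do rewrite mulrCA.
by rewrite sum_delta mulrA.
Qed.

Lemma yang_baxter x y t b p q :
  \sum_u braid_weight x y p u * column_weight y x t b u q =
  \sum_u column_weight x y t b p u * braid_weight x y u q.
Proof.
rewrite braid_weight_sum column_weight_sum /=.
(* Matrix entries are recovered by testing on the indicator of the bottom spin [b] and of the right
   spins [q]. *)
transitivity (braid_op x y (fun a a' => vertex_op y (fun e m => vertex_op x
    (fun e' b' => (b' == b)%:R * ((e, e') == q)%:R) a' m) a t) p.1 p.2).
  have E a a' : column_weight y x t b (a, a') q = vertex_op y (fun e m => vertex_op x
      (fun e' b' => (b' == b)%:R * ((e, e') == q)%:R) a' m) a t.
    by rewrite -[LHS](sum_deltar q (column_weight y x t b (a, a'))) column_weight_sum.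
  by case: p => [[c|] [d|]] /=; rewrite !E.
rewrite (vertex_op_braid x y (fun e e' b' => (b' == b)%:R * ((e, e') == q)%:R)).
apply: eq_vertex_op => a m; apply: eq_vertex_op => a' b' /=.
rewrite /braid_weight /=; case: a a' => [c|] [d|] /=; try case: ifP => _; ring.
Qed.

End Vertex.

(** * Row transfer matrices and the exchange of two rows *)

Section Rows.
Variables (A : comNzRingType) (r N : nat).
Implicit Types (x y z : A) (t b : {ffun 'I_N.+1 -> spin r}) (c d : 'I_r).

(** Columns are numbered from right to left, so the chain starts at the right boundary spin [a] and
    ends at the + on the left; [p] is the right edge of column [j] and [q] its left edge. *)
Definition row_weight z (a : spin r) t b : A :=
  chain (fun j p q => ring_weight z q (ffun_nth None t j) p (ffun_nth None b j)) N.+1 a None.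

Lemma row_weight2 x y a a' t b :
  \sum_v row_weight x a t v * row_weight y a' v b =
  chain (fun j p q => column_weight x y (ffun_nth None t j) (ffun_nth None b j) q p) N.+1
    (a, a') (None, None).
Proof.
by rewrite (chain_couple None (fun j m p q => ring_weight x q (ffun_nth None t j) p m)
  (fun j m p q => ring_weight y q m p (ffun_nth None b j))).
Qed.

(* The Yang--Baxter equation, moved across all columns: on the left boundary
   the braid acts as the scalar [x], on the right one it mixes [(c, d)] and
   [(d, c)]. *)
Lemma row_weight2_swap x y c d t b : (c < d)%N ->
  (x - y) * (\sum_v row_weight x (Some d) t v * row_weight y (Some c) v b) =
  y * (\sum_v row_weight x (Some c) t v * row_weight y (Some d) v b)
  - x * (\sum_v row_weight y (Some c) t v * row_weight x (Some d) v b).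
Proof.
move=> lt_cd; rewrite !row_weight2.
set P := chain (fun j p q => column_weight y x _ _ q p).
set Q := chain (fun j p q => column_weight x y _ _ q p).
have : \sum_u P N.+1 (Some c, Some d) u * braid_weight x y (None, None) u =
    \sum_u braid_weight x y u (Some c, Some d) * Q N.+1 u (None, None).
  (* The chain runs leftwards and the braid rightwards, hence the transposed arguments. *)
  apply: (chain_intertwine (S := fun p q => braid_weight x y q p)) => j p q _.
  under eq_bigr do rewrite mulrC.
  by rewrite yang_baxter; apply: eq_bigr => u _; rewrite mulrC.
under eq_bigr do rewrite mulrC.
rewrite braid_weight_sum /= => ->.
rewrite (bigD1 (Some c, Some d)) //= (bigD1 (Some d, Some c)) /=; last first.
  by rewrite xpair_eqE !(inj_eq Some_inj) -!val_eqE /= gtn_eqF.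
rewrite big1 => [|[[e|] [f|]] /andP[]]; rewrite /braid_weight /=.
- rewrite (ltnW lt_cd) leqNgt lt_cd /= !eqxx.
  rewrite xpair_eqE !(inj_eq Some_inj) -!val_eqE /= gtn_eqF //=.
  ring.
- move=> ne ne'; rewrite (negbTE ne).
  have /negbTE-> : (Some f, Some e) != (Some c, Some d).
    by apply: contra ne' => /eqP[-> ->].
  by case: ifP; rewrite !(mulr0, mul0r, addr0).
all: by rewrite ?xpair_eqE /= ?andbF !(mulr0, mul0r, addr0).
Qed.

End Rows.

(** * Rows whose spins are forced *)

Section SinglePath.
Variables (A : comNzRingType) (r : nat) (z : A).
Implicit Types (t b : nat -> spin r) (c k : 'I_r).

Let row t b := chain (fun j p q => ring_weight z q (t j) p (b j)).

(** A color on the right edge must enter from the top or from the left, and both carry only +. *)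
Lemma row_empty_color t b n c :
  (forall j, (j < n)%N -> t j = None) -> row t b n (Some c) None = 0.
Proof.
elim: n t b c => [//|n IHn] t b c t0; rewrite /row /= big1 // => -[d|] _.
  rewrite [X in _ * X](IHn (fun j => t j.+1) (fun j => b j.+1)) ?mulr0 // => j lt_j.
  exact: t0.
by rewrite t0 // mul0r.
Qed.

Lemma row_empty t b n :
  (forall j, (j < n)%N -> t j = None) ->
  row t b n None None = \prod_(j < n) (b j == None)%:R.
Proof.
elim: n t b => [|n IHn] t b t0; rewrite /row /=; first by rewrite big_ord0.
rewrite big_ord_recl (bigD1 None) //= big1 ?addr0 => [|[c|] // _].
  rewrite t0 // [X in _ * X](IHn (fun j => t j.+1) (fun j => b j.+1)); last first.
    by move=> j lt_j; apply: t0.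
  by case: (b 0%N).
rewrite [X in _ * X](row_empty_color (t := fun j => t j.+1) (fun j => b j.+1)) ?mulr0 //.
by move=> j lt_j; apply: t0.
Qed.

(** The color [k] turns right at column [p], with weight 1. It is larger than every color it then
    meets, so it keeps to the horizontal edges while those colors go straight down; each of the [p]
    columns to the right of the turn contributes [z]. *)
Lemma row_path t b n p k : (p < n)%N -> t p = Some k ->
  (forall j, (p < j < n)%N -> t j = None) ->
  (forall j d, (j < p)%N -> t j = Some d -> (k < d)%N) ->
  row t b n (Some k) None =
  z ^+ p * \prod_(j < n) (b j == if (j : nat) == p then None else t j)%:R.
Proof.
elim: n t b p => [//|n IHn] t b [|p] lt_p tp t_left t_right.
  rewrite /row /= big_ord_recl /= (bigD1 None) //= big1 ?addr0 => [|[c|] // _]; last first.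
    rewrite [X in _ * X](row_empty_color (t := fun j => t j.+1) (fun j => b j.+1)) ?mulr0 //.
    by move=> j lt_j; apply: t_left.
  rewrite [X in _ * X](row_empty (t := fun j => t j.+1) (fun j => b j.+1)); last first.
    by move=> j lt_j; apply: t_left.
  rewrite expr0 mul1r tp; congr (_ * _).
    by case: (b 0%N) => [?|] /=; rewrite ?eqxx.
  by apply: eq_bigr => j _ /=; rewrite t_left //; apply: (ltn_ord j).
(* Read leftwards, [k] on the right edge forces [k] on the left edge and the top spin on the bottom
   edge. *)
have w0 u : ring_weight z u (t 0%N) (Some k) (b 0%N) =
    (u == Some k)%:R * (z * (b 0%N == t 0%N)%:R).
  case t0 : (t 0%N) => [d|]; last first.
    case: u (b 0%N) => [c|] [f|] //=; rewrite ?mulr0 ?mul0r //.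
    by rewrite (inj_eq Some_inj) eq_sym; case: eqP => _; rewrite ?mul0r ?mulr1 ?mul1r.
  have lt_kd : (k < d)%N by apply: t_right t0.
  case: u (b 0%N) => [c|] [f|] //=; rewrite ?mulr0 ?mul0r //; last first.
    by case: eqP => // kd; rewrite kd ltnn in lt_kd.
  rewrite !(inj_eq Some_inj) /max_color /min_color.
  have [ck|ne_ck] := eqVneq c k.
    by rewrite ck (ltnW lt_kd) eqxx /= mul1r; case: eqP; rewrite ?mulr1 ?mulr0.
  rewrite mul0r; case: (leqP c d) => _; first by rewrite eq_sym (negbTE ne_ck).
  by case: eqP => // kd; rewrite kd ltnn in lt_kd.
rewrite /row /=; under eq_bigr do rewrite w0 -mulrA.
rewrite sum_delta [X in _ * X](IHn (fun j => t j.+1) (fun j => b j.+1) p) //.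
- rewrite [in RHS]big_ord_recl exprS /= -!mulrA; congr (_ * _).
  by rewrite mulrCA.
- by move=> j lt_j; apply: t_left.
- by move=> j d lt_j; apply: t_right.
Qed.

End SinglePath.

Lemma prod_eq_ffun (A : comNzRingType) (I : finType) (T : eqType) (f g : {ffun I -> T}) :
  \prod_i (f i == g i)%:R = (f == g)%:R :> A.
Proof.
have [->|/eqP ne_fg] := eqVneq f g; first by rewrite big1 // => i _; rewrite eqxx.
have [i ne_i] : exists i, f i != g i.
  apply/existsP; apply: contra_notT ne_fg; rewrite negb_exists => /forallP eq_fg.
  by apply/ffunP => i; apply/eqP; rewrite -[_ == _]negbK.
by rewrite (bigD1 i) //= (negbTE ne_i) mul0r.
Qed.

(** * The partition function as a product of row transfer matrices *)

Section PartitionFunction.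
Variables (A : comNzRingType) (r N : nat).
Implicit Types (z : 'I_r -> A) (lam : 'I_r -> nat) (w : 'S_r).

(** Working over a ring allows the parameters to be indeterminates; evaluation and permutation of
    variables are then ring morphisms applied to the parameters. *)
Definition ring_partition z lam w : A :=
  \sum_(s : state r N) \prod_(k < r) \prod_(j < N.+1)
    ring_weight (z k)
      (horizontal_spin w s k j.+1) (vertical_spin lam s k j)
      (horizontal_spin w s k j) (vertical_spin lam s k.+1 j).

Definition config := {ffun 'I_N.+1 -> spin r}.

Definition rows z (c : 'I_r -> 'I_r) (k : nat) (t b : config) : A :=
  oapp (fun k' => row_weight (z k') (Some (c k')) t b) 0 (insub k).

Lemma rows_ord z c (k : 'I_r) t b : rows z c k t b = row_weight (z k) (Some (c k)) t b.
Proof. by rewrite /rows valK. Qed.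

Definition top_config lam : config := [ffun j : 'I_N.+1 => top_spin lam j].
Definition empty_config : config := [ffun=> None].

End PartitionFunction.

Lemma ring_partition_chain (A : comNzRingType) r N (z : 'I_r -> A) lam (w : 'S_r) :
  (0 < r)%N ->
  ring_partition N z lam w =
  chain (rows (N := N) z (w^-1)%g) r (top_config N lam) (empty_config r N).
Proof.
case: r z lam w => // n z lam w _; rewrite chain_paths.
(* Level 0 of [V] is the top boundary, and the default value gives the empty bottom boundary at
   level [n.+1]. Likewise [H] has the right boundary at index 0 and the left + at index [N.+1]. *)
pose V (v : {ffun 'I_n -> config n.+1 N}) k :=
  if k is k'.+1 then ffun_nth (empty_config _ N) v k' else top_config N lam.
pose H (h : {ffun 'I_N -> spin n.+1}) (k : 'I_n.+1) j :=
  if j is j'.+1 then ffun_nth None h j' else Some ((w^-1)%g k).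
transitivity (\sum_(v : {ffun 'I_n -> config n.+1 N})
  \sum_(h : {ffun 'I_n.+1 -> {ffun 'I_N -> spin n.+1}}) \prod_k \prod_(j < N.+1)
    ring_weight (z k) (H (h k) k j.+1) (V v k j) (H (h k) k j) (V v k.+1 j)).
  rewrite [RHS]pair_big /ring_partition /=.
  rewrite (reindex (fun p : {ffun 'I_n -> config n.+1 N} *
      {ffun 'I_n.+1 -> {ffun 'I_N -> spin n.+1}} =>
    ([ffun q => p.2 q.1 q.2], [ffun q => p.1 q.1 q.2]) : state n.+1 N)) /=; last first.
    exists (fun s : state n.+1 N =>
      ([ffun k => [ffun j => s.2 (k, j)]], [ffun k => [ffun j => s.1 (k, j)]])).
      move=> [v h] _; congr (_, _); apply/ffunP => k; apply/ffunP => j; rewrite !ffunE //.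
    move=> [h v] _; congr (_, _); apply/ffunP => -[k j]; rewrite !ffunE //.
  apply: eq_bigr => -[v h] _; apply: eq_bigr => k _; apply: eq_bigr => j _ /=.
  congr ring_weight.
  - by rewrite /horizontal_spin /H /ffun_nth; case: insub => //= j'; rewrite ffunE.
  - case: k => -[|k] lt_k /=; rewrite /V ?ffunE //= /ffun_nth.
    by case: insub => //= *; rewrite !ffunE.
  - rewrite /horizontal_spin /H /ffun_nth; case: j => -[|j] //= _.
    by case: insub => //= j'; rewrite ffunE.
  - by rewrite /V /= /ffun_nth; case: insub => //= *; rewrite !ffunE.
(* Once the vertical spins are fixed the rows decouple: the sum over [h] is a product of sums, one
   per row. *)
apply: eq_bigr => v _; rewrite -(bigA_distr_bigA (fun k h => \prod_(j < N.+1)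
    ring_weight (z k) (H h k j.+1) (V v k j) (H h k j) (V v k.+1 j))).
apply: eq_bigr => k _; rewrite rows_ord /row_weight chain_paths.
apply: eq_bigr => h _; apply: eq_bigr => j _; rewrite /= !ffun_nth_ord.
by case: k j => -[|k] lt_k [[|j] lt_j].
Qed.


Lemma eq_ring_partition (A : comNzRingType) r N (z z' : 'I_r -> A) lam w :
  z =1 z' -> ring_partition N z lam w = ring_partition N z' lam w.
Proof.
move=> eq_z; apply: eq_bigr => s _; apply: eq_bigr => k _; apply: eq_bigr => j _.
by rewrite eq_z.
Qed.

Lemma ring_weight_rmorph (A B : comNzRingType) (f : {rmorphism A -> B}) r z
    (l t p b : spin r) : f (ring_weight z l t p b) = ring_weight (f z) l t p b.
Proof.
by case: l t p b => [?|] [?|] [?|] [?|] /=; rewrite ?rmorph0 ?rmorph1 //;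
  case: ifP; rewrite ?rmorph0 ?rmorph1.
Qed.

Lemma ring_partition_rmorph (A B : comNzRingType) (f : {rmorphism A -> B}) r N
    (z : 'I_r -> A) lam w :
  f (ring_partition N z lam w) = ring_partition N (f \o z) lam w.
Proof.
rewrite rmorph_sum; apply: eq_bigr => s _; rewrite rmorph_prod; apply: eq_bigr => k _.
rewrite rmorph_prod; apply: eq_bigr => j _ /=.
exact: ring_weight_rmorph.
Qed.

(** [w * simple_refl i] is s_i w as a composition of maps, so it swaps the colors leaving rows i and
    i+1, while [z \o simple_refl i] swaps the parameters of these rows. All other rows agree, and
    [row_weight2_swap] relates the two that change. *)
Lemma ring_partition_swap (A : comNzRingType) r N (z : 'I_r -> A) lam (w : 'S_r)
    (i : 'I_r.-1) :
  ((w^-1)%g (ord_lo i) < (w^-1)%g (ord_hi i))%N ->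
  (z (ord_lo i) - z (ord_hi i)) * ring_partition N z lam (w * simple_refl i)%g =
  z (ord_hi i) * ring_partition N z lam w
  - z (ord_lo i) * ring_partition N (z \o simple_refl i) lam w.
Proof.
move=> lt_i; have r_gt0 : (0 < r)%N by apply: leq_ltn_trans (ltn_ord (ord_lo i)).
rewrite !ring_partition_chain // -mulNr.
have other (k : 'I_r) : k != i :> nat -> k != i.+1 :> nat -> simple_refl i k = k.
  by move=> ki ki1; rewrite tpermD // -val_eqE /= eq_sym.
have VE k : ((w * simple_refl i)^-1)%g k = (w^-1)%g (simple_refl i k).
  by rewrite invMg permM tpermV.
apply: (chain_linear (i := i)).
- exact: ltn_ord (ord_hi i).
- move=> k x y ki ki1; rewrite /rows; case: insubP => //= k' _ Ek.
  by rewrite VE other // Ek.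
- move=> k x y ki ki1; rewrite /rows; case: insubP => //= k' _ Ek.
  by rewrite VE other // Ek.
move=> x y; rewrite mulNr.
have loE zf c t b : rows zf c i t b = row_weight (zf (ord_lo i)) (Some (c (ord_lo i))) t b.
  exact: (rows_ord _ _ (ord_lo i)).
have hiE zf c t b : rows zf c i.+1 t b = row_weight (zf (ord_hi i)) (Some (c (ord_hi i))) t b.
  exact: (rows_ord _ _ (ord_hi i)).
under eq_bigr do rewrite loE hiE !VE [simple_refl i _]tpermL [simple_refl i _]tpermR.
under [X in _ * X - _]eq_bigr do rewrite loE hiE.
under [X in _ - _ * X]eq_bigr do
  rewrite loE hiE /= [simple_refl i _]tpermL [simple_refl i _]tpermR.
exact: row_weight2_swap.
Qed.

(** * The case of the identity permutation *)

Section Identity.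
Variables (r N : nat) (lam : 'I_r -> nat).
Hypothesis lam_dec : forall i j : 'I_r, (i <= j)%N -> (lam j <= lam i)%N.
Hypothesis lam_bound : forall i : 'I_r, (lam i + (r - i.+1) <= N)%N.

Definition color_column (i : 'I_r) := (lam i + (r - i.+1))%N.

Lemma ltn_color_column (i j : 'I_r) : (color_column i < color_column j)%N = (j < i)%N.
Proof.
have dec (i' j' : 'I_r) : (i' < j')%N -> (color_column j' < color_column i')%N.
  move=> lt_ij; have := lam_dec (ltnW lt_ij); have := ltn_ord j'; rewrite /color_column; lia.
have [/dec//|/dec|/val_inj->] := ltngtP j i; last by rewrite ltnn.
by move=> lt_p; rewrite ltnNge (ltnW lt_p).
Qed.

(** The vertical spins above row [k] in the only contributing state: the colors of index below [k]
    have already left on the right. *)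
Definition config_from (k : nat) : config r N :=
  [ffun j : 'I_N.+1 => [pick i : 'I_r | (k <= i)%N && (color_column i == j)]].

(** Distinct colors occupy distinct columns, so [pick] has at most one candidate. *)
Lemma config_fromP k (j : 'I_N.+1) (i : 'I_r) :
  reflect (config_from k j = Some i) ((k <= i)%N && (color_column i == j)).
Proof.
rewrite ffunE; case: pickP => [i' /andP[le_k /eqP pi']|none]; last first.
  by rewrite none; constructor.
apply: (iffP andP) => [[_ /eqP pi]|[<-]]; last by rewrite le_k pi'.
have := ltn_color_column i i'; have := ltn_color_column i' i.
rewrite pi pi' ltnn => /esym lt_i'i /esym lt_ii'.
by congr Some; apply/ord_inj/eqP; rewrite eqn_leq leqNgt lt_i'i leqNgt lt_ii'.
Qed.

Lemma ring_partition1 (A : comNzRingType) (z : 'I_r -> A) : (0 < r)%N ->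
  ring_partition N z lam 1%g = \prod_(k < r) z k ^+ color_column k.
Proof.
move=> r_gt0; rewrite ring_partition_chain //.
have -> : top_config N lam = config_from 0 by apply/ffunP => j; rewrite !ffunE.
rewrite (chain_deterministic
  (a := fun k => oapp (fun i => z i ^+ color_column i) 1 (insub k))).
  have -> : config_from r = empty_config r N.
    apply/ffunP => j; rewrite !ffunE; case: pickP => // i.
    by rewrite leqNgt ltn_ord.
  by rewrite eqxx mulr1; apply: eq_bigr => k _; rewrite valK.
move=> k u lt_k; rewrite /rows; case: insubP => [k' _ Ek|]; last by rewrite lt_k.
rewrite /= invg1 perm1 /row_weight -{}Ek {k lt_k}.
have extE j (lt_j : (j < N.+1)%N) c : ffun_nth None c j = c (Ordinal lt_j) :> spin r.
  by rewrite -(ffun_nth_ord None c).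
have lt_p : (color_column k' < N.+1)%N by rewrite ltnS lam_bound.
rewrite (row_path _ (ffun_nth None u) lt_p (k := k') (t := ffun_nth None (config_from k'))) //.
(* Removing the color [k'] from [config_from k'] leaves [config_from k'.+1]. *)
- rewrite -prod_eq_ffun; congr (_ * _); apply: eq_bigr => j _; rewrite !ffun_nth_ord.
  congr (_ == _)%:R; case: eqP => [Ej|ne_j].
    case E : (config_from _ j) => [i|] //; move/config_fromP: E => /andP[lt_k /eqP Ei].
    by have := ltn_color_column i k'; rewrite lt_k Ei Ej ltnn.
  rewrite !ffunE; apply: eq_pick => i /=.
  have [Ei|_] := eqVneq (color_column i) j; last by rewrite !andbF.
  rewrite !andbT leq_eqVlt; case: eqP => // /val_inj Eki.
  by rewrite -Ei Eki in ne_j.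
- by rewrite extE; apply/config_fromP; rewrite leqnn eqxx.
- move=> j /andP[lt_pj lt_j]; rewrite extE.
  case E : (config_from _ _) => [i|] //; move/config_fromP: E => /andP[le_k /eqP /= Ei].
  by have := ltn_color_column k' i; rewrite Ei lt_pj ltnNge le_k.
- move=> j d lt_jp; have lt_j := ltn_trans lt_jp lt_p; rewrite extE.
  by move/config_fromP => /andP[_ /eqP /= Ed]; rewrite -(ltn_color_column d k') Ed.
Qed.

End Identity.

(** * The exchange property of reduced words *)

(** As long as the leading reflection keeps the order of the pair, conjugate the transposition past
    it and recurse; otherwise delete that letter. *)
Lemma word_perm_exchange r (s : seq 'I_r.-1) (x y : 'I_r) :
  (x < y)%N -> (((word_perm s)^-1)%g y < ((word_perm s)^-1)%g x)%N ->
  exists2 t : seq 'I_r.-1, (size t < size s)%N & word_perm t = (word_perm s * tperm x y)%g.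
Proof.
elim: s x y => [|j s IHs] x y lt_xy /=.
  by rewrite invg1 !perm1 ltnNge (ltnW lt_xy).
rewrite invMg !permM tpermV -/(simple_refl j) => inv_xy.
have [lt_sxy|ge_sxy] := ltnP (simple_refl j x) (simple_refl j y).
  have [t szt Et] := IHs _ _ lt_sxy inv_xy.
  exists (j :: t) => //=; rewrite Et -tpermJ /conjg tpermV.
  by rewrite -!mulgA -/(simple_refl j) tperm2 mulg1.
(* A simple reflection reverses only the pair that it exchanges, so the transposition cancels the
   letter [j]. *)
exists s => //.
suff [-> ->] : x = ord_lo j /\ y = ord_hi j by rewrite -mulgA tperm2 mulg1.
have siE (u : 'I_r) : simple_refl j u =
    (if u == j :> nat then j.+1 else if u == j.+1 :> nat then (j : nat) else u) :> nat.
  rewrite /simple_refl; case: tpermP => [->|->|/eqP + /eqP].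
  - by rewrite /= eqxx.
  - by rewrite /= gtn_eqF // eqxx.
  - by rewrite -!val_eqE /= => /negbTE-> /negbTE->.
move: ge_sxy; rewrite !siE.
by repeat case: eqP => ?; move=> ?; split; apply: val_inj => /=; lia.
Qed.

(** If the inequality failed, the exchange property would give a word for [w] shorter than [s]. *)
Lemma reduced_word_cons r (w : 'S_r) i s : reduced_word w (i :: s) ->
  reduced_word (word_perm s) s /\
  (((word_perm s)^-1)%g (ord_lo i) < ((word_perm s)^-1)%g (ord_hi i))%N.
Proof.
move=> /andP[/eqP Ew /forallP minw].
have min_size t : word_perm t = w -> (size s < size t)%N.
  move=> Et; rewrite ltnNge; apply/negP; rewrite -ltnS => lt_t.
  by have /forallP /(_ (in_tuple t)) := minw (Ordinal lt_t); rewrite /= Et eqxx.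
split.
  rewrite /reduced_word eqxx; apply/forallP => n; apply/forallP => t; apply/eqP => Et.
  have := min_size (i :: t); rewrite /= Et -Ew => /(_ erefl).
  by rewrite size_tuple ltnS leqNgt ltn_ord.
rewrite ltnNge; apply/negP; rewrite leq_eqVlt => /orP[/eqP /val_inj /perm_inj|].
  by move/(congr1 val)/eqP => /=; rewrite gtn_eqF.
move=> /(word_perm_exchange (ltnSn i : ord_lo i < ord_hi i)%N) [t lt_t Et].
have /min_size : word_perm t = w by rewrite Et -Ew.
by rewrite ltnNge (ltnW lt_t).
Qed.

(** * Divided differences and the recursion over a reduced word *)

Lemma monomial_nat (K : fieldType) r (m : 'I_r -> nat) :
  monomial K (fun i => (m i)%:Z) = (\prod_i 'X_i ^+ m i : {mpoly K[r]})%:F.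
Proof. by rewrite /monomial rmorph_prod; apply: eq_bigr => i _; rewrite -exprnP rmorphXn. Qed.

Lemma mpolyU_sub_neq0 (K : fieldType) r (i j : 'I_r) : i != j ->
  'X_i - 'X_j != 0 :> {mpoly K[r]}.
Proof.
move=> ne_ij; rewrite subr_eq0; apply/eqP => /(congr1 (fun p : {mpoly K[r]} => p@_U_(i)%MM)).
by rewrite !mcoeffXU eqxx eq_sym (negbTE ne_ij) => /eqP; rewrite oner_eq0.
Qed.

(** Meant for a = z_i, b = z_(i+1), with [q] being z^rho and [q'] its image under s_i: the recursion
    for Z becomes a divided difference of Z / z^rho. *)
Lemma twisted_difference (F : fieldType) (a b q q' Z Z' Z'' : F) :
  b != 0 -> q != 0 -> q' != 0 -> a - b != 0 -> q * b = a * q' ->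
  (a - b) * Z'' = b * Z - a * Z' -> Z'' = q * ((Z / q - Z' / q') / (a / b - 1)).
Proof.
move=> b0 q0 q'0 ab0 Eq EZ.
have a0 : a != 0 by apply: contra_neq q0 => a0; apply: (mulIf b0); rewrite Eq a0 !mul0r.
have -> : Z'' = (b * Z - a * Z') / (a - b) by rewrite -EZ mulrC mulKf.
have -> : q = a * q' / b by rewrite -Eq mulfK.
by field; rewrite mulN1r a0 b0 q'0 ab0.
Qed.

Section Demazure.
Variables (K : fieldType) (r N : nat) (lam : 'I_r -> nat).
Hypothesis lam_dec : forall i j : 'I_r, (i <= j)%N -> (lam j <= lam i)%N.
Hypothesis lam_bound : forall i : 'I_r, (lam i + (r - i.+1) <= N)%N.

Lemma msymU (s : 'S_r) i : msym s 'X_i = 'X_(s i) :> {mpoly K[r]}.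
Proof. by rewrite /msym mmapX mmap1U. Qed.

Let X (i : 'I_r) : {mpoly K[r]} := 'X_i.
Let Xrho : {mpoly K[r]} := \prod_(k < r) X k ^+ (r - k.+1).

(** The exponents of rho at neighbouring positions differ by one, so s_i multiplies z^rho by z_(i+1)
    / z_i. *)
Lemma Xrho_simple_refl i :
  Xrho * X (ord_hi i) = X (ord_lo i) * msym (simple_refl i) Xrho.
Proof.
have ne_lohi : ord_hi i != ord_lo i by rewrite -val_eqE /= gtn_eqF.
rewrite /Xrho rmorph_prod /=.
rewrite (bigD1 (ord_lo i)) //= (bigD1 (ord_hi i)) //=.
rewrite [in RHS](bigD1 (ord_lo i)) //= [in RHS](bigD1 (ord_hi i)) //=.
rewrite !rmorphXn /= !msymU [simple_refl i _]tpermL [simple_refl i _]tpermR.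
rewrite [in RHS](eq_bigr (fun k => X k ^+ (r - k.+1))); last first.
  by move=> k /andP[ne_lo ne_hi]; rewrite rmorphXn /= msymU tpermD // eq_sym.
have -> : (r - i.+1 = (r - i.+2).+1)%N by have := ltn_ord (ord_hi i) => /=; lia.
rewrite !exprS; move: (_ ^+ _) (_ ^+ _) (\prod_(k | _) _) => a b c.
by rewrite -!mulrA (mulrC c) [b * _]mulrCA (mulrCA b) (mulrCA a).
Qed.

Lemma ring_partition_demazure s w : (0 < r)%N -> reduced_word w s ->
  (ring_partition N X lam w)%:F =
  monomial K (@rho r) * foldr (fun i g => demazure_op i g)
    (monomial K (fun i => (lam i)%:Z)) s.
Proof.
move=> r_gt0; rewrite (monomial_nat K (fun k => (r - k.+1)%N)) -/Xrho.
elim: s w => [|i s IHs] w red_w.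
  have /andP[/eqP <- _] := red_w.
  rewrite /= (ring_partition1 lam_dec lam_bound) // monomial_nat -rmorphM -big_split /=.
  by congr (_%:F); apply: eq_bigr => k _; rewrite -exprD addnC.
have [red_s lt_i] := reduced_word_cons red_w.
have [/eqP <- _] := andP red_w.
have Xrho0 : Xrho != 0.
  by apply/prodf_neq0 => k _; rewrite expf_neq0 // /X mpolyX_neq0.
have Xrho0' : Xrho%:F != 0 by rewrite tofrac_neq0.
have {}IHs := IHs _ red_s; rewrite /=; set g := foldr _ _ _ in IHs *.
have -> : g = (ring_partition N X lam (word_perm s))%:F / Xrho%:F.
  by rewrite IHs mulrC mulKf.
rewrite /demazure_op (permute_vars_frac _ _ Xrho0).
apply: twisted_difference Xrho0' _ _ _ _.
- exact: mpolyX_tofrac_neq0.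
- by apply: tofrac_neq0; rewrite msym_eq0.
- rewrite -tofracB; apply/tofrac_neq0/mpolyU_sub_neq0.
  by rewrite -val_eqE /= ltn_eqF.
- by rewrite /var -!tofracM Xrho_simple_refl.
rewrite /var -tofracB -!tofracM -tofracB; congr (_%:F).
rewrite (ring_partition_swap N X lam lt_i); congr (_ - _ * _).
(* Permuting the variables of the polynomial amounts to permuting the parameters of the rows. *)
rewrite (ring_partition_rmorph (msym (simple_refl i))).
by apply: eq_ring_partition => k /=; rewrite msymU.
Qed.

End Demazure.

Theorem theorem4p4 (R : realType) (r : nat) (hr : (0 < r)%N)
    (lam : 'I_r -> nat)
    (hlam : forall i j : 'I_r, (i <= j)%N -> (lam j <= lam i)%N)
    (N : nat) (hN : (lam (Ordinal hr) + (r - 1) <= N)%N)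
    (z : 'I_r -> complex R) (hz : forall i, z i != 0) (w : 'S_r) :
  partition_function N z lam w =
  laurent_eval z
    (monomial (complex R) (@rho r) *
     demazure w (monomial (complex R) (fun i => (lam i)%:Z))).
Proof.
have lam_bound i : (lam i + (r - i.+1) <= N)%N.
  by have := hlam (Ordinal hr) i (leq0n _); lia.
rewrite /demazure -(ring_partition_demazure _ hlam lam_bound hr (xchooseP _)).
(* The right-hand side is now a polynomial; the trivial denominator ['X_[0]] puts it in the form
   that [laurent_evalE] evaluates. *)
rewrite -[X in laurent_eval z X]divr1 -tofrac1 -(mpolyX0 r (complex R)) laurent_evalE //.
rewrite mpolyX0 meval1 divr1 (ring_partition_rmorph (meval z)).
by apply: eq_ring_partition => k; rewrite /= mevalXU.
Qed.
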